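(* Let $f\colon\mathbb{R}\to\mathbb{R}$ be a smooth function such that $f$ and $\dot f$ are bounded on $\mathbb{R}$, and let $g\colon\mathbb{R}\to\mathbb{R}$ be a smooth periodic function with period $T>0$ and zero mean, $\frac1T\int_0^T g(t)\,dt=0$. For $\lambda>0$ consider the equation $$\ddot x=f(t)\sin x-(1+g(\lambda t))\cos x .$$ Then there exists $\lambda_0$ such that for every $\lambda\geqslant\lambda_0$ this equation has a solution $x(t)$ satisfying $x(t)\in(0,\pi)$ for all $t>0$.
   Context: The equation describes an inverted pendulum with a horizontally moving pivot point (horizontal forcing $f(t)$) in a gravity field oscillating as $1+g(\lambda t)$. *)

(* Defs.v *)
From Stdlib Require Import Reals.
Open Scope R_scope.

Definition deriv_tower (h : R -> R) (D : nat -> R -> R) : Prop :=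
  (forall t, D 0%nat t = h t) /\
  (forall (n : nat) (t : R), derivable_pt_lim (D n) t (D (S n) t)).

Definition smooth (h : R -> R) : Prop := exists D, deriv_tower h D.

Definition is_solution (f g : R -> R) (lambda : R) (x : R -> R) : Prop :=
  exists v : R -> R, forall t : R,
    derivable_pt_lim x t (v t) /\
    derivable_pt_lim v t (f t * sin (x t) - (1 + g (lambda * t)) * cos (x t)).

(* Main.v *)
Require Import Defs.
From Stdlib Require Import Reals ZArith Lra Lia.
From Coquelicot Require Import Coquelicot.
Open Scope R_scope.

(** Write [g = H''] with [H] periodic, which is possible since [g] has zero mean.  For a suitable
    constant [d] of order [1/lambda^2], the small function [a(t) = d - H(lambda t)/lambda^2] is
    positive and [a'' = - g(lambda t)] cancels the fast forcing near [x = 0] up to [O(a)], so the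
    remaining gravity term makes [a] a lower solution for large [lambda]; symmetrically [PI - a]
    is an upper solution.  A solution on the whole line lies between them. *)

(** * Calculus preliminaries: consequences of the mean value theorem *)

Lemma is_derive_nondecreasing (F F' : R -> R) :
  (forall t, is_derive F t (F' t)) -> (forall t, 0 <= F' t) ->
  forall s t, s <= t -> F s <= F t.
Proof.
intros HF Hpos s t Hst.
destruct (MVT_gen F s t F') as [c [_ Hc]].
- intros x _; apply HF.
- intros x _; apply continuity_pt_filterlim.
  apply (ex_derive_continuous F); exists (F' x); apply HF.
- specialize (Hpos c); nra.
Qed.

Lemma is_derive_lipschitz (F F' : R -> R) (L : R) :
  (forall t, is_derive F t (F' t)) -> (forall t, Rabs (F' t) <= L) ->
  forall s t, Rabs (F t - F s) <= L * Rabs (t - s).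
Proof.
intros HF HL s t.
destruct (MVT_gen F s t F') as [c [_ Hc]].
- intros x _; apply HF.
- intros x _; apply continuity_pt_filterlim.
  apply (ex_derive_continuous F); exists (F' x); apply HF.
- rewrite Hc, Rabs_mult.
  apply Rmult_le_compat_r; [apply Rabs_pos | apply HL].
Qed.

Lemma sin_lipschitz (x y : R) : Rabs (sin x - sin y) <= Rabs (x - y).
Proof.
rewrite <- (Rmult_1_l (Rabs (x - y))).
apply (is_derive_lipschitz sin cos).
- intros t; apply is_derive_Reals, derivable_pt_lim_sin.
- intros t; apply Rabs_le, COS_bound.
Qed.

Lemma cos_lipschitz (x y : R) : Rabs (cos x - cos y) <= Rabs (x - y).
Proof.
rewrite <- (Rmult_1_l (Rabs (x - y))).
apply (is_derive_lipschitz cos (fun t => - sin t)).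
- intros t; apply is_derive_Reals, derivable_pt_lim_cos.
- intros t; rewrite Rabs_Ropp; apply Rabs_le, SIN_bound.
Qed.

Lemma RInt_is_derive (h : R -> R) :
  (forall t, continuous h t) ->
  forall t, is_derive (fun s => RInt h 0 s) t (h t).
Proof.
intros Hh t.
apply (is_derive_RInt h (fun s => RInt h 0 s) 0 t); [|apply Hh].
apply filter_forall; intros s.
apply (RInt_correct h), ex_RInt_continuous; intros; apply Hh.
Qed.

(** * Periodic functions: boundedness and periodic primitives *)

Lemma periodic_shift (u : R -> R) (T : R) :
  (forall t, u (t + T) = u t) ->
  forall (n : nat) t, u (t + INR n * T) = u t.
Proof.
intros Hu n; induction n as [|n IH]; intros t.
- f_equal; simpl; ring.
- rewrite S_INR, <- (IH t), <- (Hu (t + INR n * T)); f_equal; ring.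
Qed.

Lemma periodic_continuous_bounded (u : R -> R) (T : R) :
  0 < T -> (forall t, u (t + T) = u t) -> (forall t, continuous u t) ->
  exists B, 0 < B /\ forall t, Rabs (u t) <= B.
Proof.
intros HT Hu Hc.
destruct (continuity_ab_maj (fun t => Rabs (u t)) 0 T) as [m [Hm _]].
- lra.
- intros c _; apply continuity_pt_filterlim.
  apply (continuous_comp u Rabs); [apply Hc|].
  apply (continuous_abs (K := R_AbsRing)).
- assert (Hbd : forall t, Rabs (u t) <= Rabs (u m)).
  { intros t.
    assert (Hz : exists z : Z, 0 <= t - IZR z * T <= T).
    { exists (Int_part (t / T)).
      destruct (base_Int_part (t / T)) as [H1 H2].
      set (z := IZR (Int_part (t / T))) in *.
      assert (Ht : t = t / T * T) by (field; lra).
      split; nra. }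
    destruct Hz as [z Hz].
    replace (u t) with (u (t - IZR z * T)); [apply Hm; exact Hz|].
    (* [periodic_shift] moves forward by natural multiples of [T], so the sign of [z] decides which
       of the two points gets shifted onto the other. *)
    destruct (Z.le_ge_cases 0 z) as [H0|H0].
    - rewrite <- (periodic_shift u T Hu (Z.to_nat z)); f_equal.
      rewrite INR_IZR_INZ, Z2Nat.id by lia; ring.
    - rewrite <- (periodic_shift u T Hu (Z.to_nat (- z)) t); f_equal.
      rewrite INR_IZR_INZ, Z2Nat.id, opp_IZR by lia; ring. }
  exists (Rabs (u m) + 1); split.
  + pose proof (Rabs_pos (u m)); lra.
  + intros t; specialize (Hbd t); lra.
Qed.

(** The increment of a primitive over one period is constant, and equals the integral of [u] over a
    period, which vanishes. Subtracting the mean makes the primitive zero-mean as well, so that the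
    construction can be iterated from [g] to [G] to [H]. *)
Lemma periodic_primitive (u : R -> R) (T : R) :
  0 < T -> (forall t, u (t + T) = u t) -> (forall t, continuous u t) ->
  RInt u 0 T = 0 ->
  exists U, (forall t, is_derive U t (u t)) /\ (forall t, U (t + T) = U t) /\
    RInt U 0 T = 0.
Proof.
intros HT Hu Hc H0.
set (V := fun s => RInt u 0 s).
assert (HV : forall t, is_derive V t (u t)) by (apply RInt_is_derive; exact Hc).
assert (HVc : forall t, continuous V t).
{ intros t; apply (ex_derive_continuous V); exists (u t); apply HV. }
assert (HVp : forall t, V (t + T) = V t).
{ assert (Hd : forall t, is_derive (fun s => V (s + T) - V s) t 0).
  { intros t.
    replace 0 with (minus (scal 1 (u (t + T))) (u t)).
    2:{ rewrite Hu; unfold minus, plus, opp, scal; simpl; unfold mult; simpl; ring. }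
    apply (is_derive_minus (fun s => V (s + T)) V); [|apply HV].
    apply (is_derive_comp V (fun s => s + T)); [apply HV|].
    auto_derive; [exact I|ring]. }
  intros t.
  assert (Hle := is_derive_lipschitz _ _ 0 Hd
                   ltac:(intros; cbv beta; rewrite Rabs_R0; lra) 0 t).
  cbv beta in Hle; rewrite Rmult_0_l in Hle.
  assert (E0 : V (0 + T) - V 0 = 0).
  { unfold V; rewrite Rplus_0_l, RInt_point, H0; unfold zero; simpl; ring. }
  rewrite E0 in Hle; revert Hle; unfold Rabs; destruct Rcase_abs; lra. }
set (m := RInt V 0 T / T).
exists (fun t => V t - m); split; [|split].
- intros t; replace (u t) with (minus (u t) 0)
    by (unfold minus, plus, opp; simpl; ring).
  apply (is_derive_minus V (fun _ => m)); [apply HV|apply (is_derive_const (K := R_AbsRing) (V := R_NormedModule) m)].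
- intros t; rewrite HVp; reflexivity.
- rewrite (RInt_minus V (fun _ => m)).
  + rewrite RInt_const; unfold m, minus, plus, opp, scal; simpl; unfold mult; simpl.
    field; lra.
  + apply (ex_RInt_continuous V); intros; apply HVc.
  + apply ex_RInt_const.
Qed.

(** * Bounded solutions on the line of the first-order equation [p' = - k p + h] *)

Lemma bounded_solution_nonneg (k B : R) (p h : R -> R) :
  0 < k -> (forall t, is_derive p t (- k * p t + h t)) ->
  (forall t, 0 <= h t) -> (forall t, Rabs (p t) <= B) ->
  forall t, 0 <= p t.
Proof.
intros Hk Hp Hh HB t.
destruct (Rle_lt_dec 0 (p t)) as [H|Hneg]; [exact H|exfalso].
assert (HB0 : 0 <= B) by (pose proof (Rabs_pos (p t)); specialize (HB t); lra).
(* A negative value grows exponentially backwards in time: [exp (k t) * p t] is nondecreasing, so [p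
   (t - d) <= exp (k d) * p t <= (1 + k d) * p t]. This [d] makes the right-hand side
   [p t - B < - B], against the bound. *)
set (d := B / (k * - p t)).
assert (Hkd : k * d * - p t = B) by (unfold d; field; lra).
assert (Hd : 0 <= d).
{ unfold d; apply Rmult_le_pos; [exact HB0|].
  apply Rlt_le, Rinv_0_lt_compat; nra. }
assert (Hmon : exp (k * (t - d)) * p (t - d) <= exp (k * t) * p t).
{ apply (is_derive_nondecreasing (fun s => exp (k * s) * p s)
           (fun s => exp (k * s) * h s)); [| |lra].
  - intros s.
    assert (He : is_derive (fun s => exp (k * s)) s (k * exp (k * s))).
    { auto_derive; [exact I|ring]. }
    generalize (is_derive_mult _ _ _ _ _ He (Hp s) Rmult_comm).
    intros Hm; evar_last; [exact Hm|].
    unfold plus, mult; simpl; ring.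
  - intros s; apply Rmult_le_pos; [apply Rlt_le, exp_pos|apply Hh]. }
replace (k * t) with (k * (t - d) + k * d) in Hmon by ring.
rewrite exp_plus, Rmult_assoc in Hmon.
apply Rmult_le_reg_l in Hmon; [|apply exp_pos].
pose proof (exp_ineq1_le (k * d)).
specialize (HB (t - d)); apply Rabs_le_between in HB.
nra.
Qed.

(** The solution is the integral of [exp (- k (t - s)) * h s] over [s] from minus infinity to [t].
    Replacing [h] by [h + M >= 0] makes the weighted primitive [Q] monotone, so its limit at minus
    infinity is an infimum, and no improper integral is needed. *)
Lemma bounded_solution_exists (k M : R) (h : R -> R) :
  0 < k -> (forall t, continuous h t) -> (forall t, Rabs (h t) <= M) ->
  exists p, (forall t, is_derive p t (- k * p t + h t)) /\
    forall t, Rabs (p t) <= M / k.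
Proof.
intros Hk Hc HM.
assert (HM' : forall t, - M <= h t <= M) by (intros; apply Rabs_le_between, HM).
set (e := fun t => exp (k * t)).
assert (He : forall t, is_derive e t (k * e t)).
{ intros t; unfold e; auto_derive; [exact I|ring]. }
assert (Hepos : forall t, 0 < e t) by (intros; apply exp_pos).
set (q := fun t => e t * (h t + M)).
assert (Hqc : forall t, continuous q t).
{ intros t; apply (continuous_mult e (fun t => h t + M)).
  - apply (ex_derive_continuous e); eexists; apply He.
  - apply (continuous_plus h (fun _ => M)); [apply Hc|apply continuous_const]. }
set (Q := fun t => RInt q 0 t).
assert (HQ : forall t, is_derive Q t (q t)) by (apply RInt_is_derive; exact Hqc).
assert (Hinc : forall s t, s <= t -> Q s <= Q t).
{ apply (is_derive_nondecreasing Q q HQ); intros t; unfold q.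
  specialize (Hepos t); specialize (HM' t); nra. }
assert (Hdec : forall s t, s <= t ->
  2 * M / k * e s - Q s <= 2 * M / k * e t - Q t).
{ apply (is_derive_nondecreasing (fun t => 2 * M / k * e t - Q t)
           (fun t => 2 * M * e t - q t)).
  - intros t; evar_last.
    + apply (is_derive_minus (fun t => 2 * M / k * e t) Q); [|apply HQ].
      apply (is_derive_scal e), He.
    + unfold minus, plus, opp; simpl; field; lra.
  - intros t; unfold q; specialize (Hepos t); specialize (HM' t); nra. }
assert (HM0 : 0 <= 2 * M / k).
{ specialize (HM' 0); apply Rmult_le_pos; [lra|].
  apply Rlt_le, Rinv_0_lt_compat, Hk. }
assert (Hlow : forall s t, Q t - Q s <= 2 * M / k * e t).
{ intros s t; destruct (Rle_lt_dec s t) as [H|H].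
  - specialize (Hdec s t H); specialize (Hepos s).
    assert (0 <= 2 * M / k * e s) by (apply Rmult_le_pos; lra); lra.
  - specialize (Hinc t s (Rlt_le _ _ H)); specialize (Hepos t).
    assert (0 <= 2 * M / k * e t) by (apply Rmult_le_pos; lra); lra. }
(* [- L] is the infimum of [Q], that is, its limit at minus infinity; [Q t + L] is then the weighted
   integral up to [t]. *)
destruct (completeness (fun y => exists t, y = - Q t)) as [L [HL1 HL2]].
- exists (2 * M / k * e 0 - Q 0); intros y [s ->].
  specialize (Hlow s 0); lra.
- exists (- Q 0), 0; reflexivity.
- assert (HL : forall t, 0 <= Q t + L <= 2 * M / k * e t).
  { intros t; split.
    - assert (- Q t <= L) by (apply HL1; exists t; reflexivity); lra.
    - assert (L <= 2 * M / k * e t - Q t); [|lra].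
      apply HL2; intros y [s ->]; specialize (Hlow s t); lra. }
  assert (Hi : forall t, exp (- k * t) * e t = 1).
  { intros t; unfold e; rewrite <- exp_plus, <- exp_0; f_equal; ring. }
  (* Subtracting [M / k], the constant solution for source [M], undoes the shift of [h] and
     recentres the range from [[0, 2 M / k]] to [[- M / k, M / k]]. *)
  exists (fun t => exp (- k * t) * (Q t + L) - M / k); split.
  + intros t.
    evar_last.
    * apply (is_derive_minus (fun t => exp (- k * t) * (Q t + L)) (fun _ => M / k));
        [|apply (is_derive_const (K := R_AbsRing) (V := R_NormedModule) (M / k))].
      apply (is_derive_mult (fun t => exp (- k * t)) (fun t => Q t + L));
        [| |exact Rmult_comm].
      -- instantiate (1 := - k * exp (- k * t)); auto_derive; [exact I|ring].
      -- apply (is_derive_plus Q (fun _ => L)); [apply HQ|].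
         apply (is_derive_const (K := R_AbsRing) (V := R_NormedModule) L).
    * unfold minus, plus, opp, zero, mult; simpl; unfold q.
      transitivity (- k * exp (- k * t) * (Q t + L) + exp (- k * t) * e t * (h t + M)).
      { ring. }
      rewrite Hi; field; lra.
  + intros t; apply Rabs_le_between.
    pose proof (exp_pos (- k * t)) as Hp; specialize (Hi t); specialize (HL t).
    assert (0 <= exp (- k * t) * (Q t + L)) by (apply Rmult_le_pos; lra).
    assert (exp (- k * t) * (Q t + L) <= exp (- k * t) * (2 * M / k * e t))
      by (apply Rmult_le_compat_l; lra).
    assert (exp (- k * t) * (2 * M / k * e t) = 2 * (M / k)).
    { transitivity (2 * M / k * (exp (- k * t) * e t)); [ring|].
      rewrite Hi; field; lra. }
    lra.
Qed.

(** * The second-order equation [w'' = k^2 w - h]: comparison and existence *)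

Lemma is_derive_reflect (p p' : R -> R) :
  (forall t, is_derive p t (p' t)) ->
  forall t, is_derive (fun s => p (- s)) t (- p' (- t)).
Proof.
intros Hp t.
evar_last.
- apply (is_derive_comp p Ropp); [apply Hp|].
  instantiate (1 := -1); auto_derive; [exact I|ring].
- unfold scal; simpl; unfold mult; simpl; ring.
Qed.

(* [w'' - k^2 w] factors as [(d/dt + k) (d/dt - k) w], so [k w - w'] and [k w + w'] solve
   first-order equations, the second one backwards in time. *)
Lemma bounded_supersolution_nonneg (k B : R) (w v h : R -> R) :
  0 < k -> (forall t, is_derive w t (v t)) ->
  (forall t, is_derive v t (k * k * w t - h t)) ->
  (forall t, 0 <= h t) -> (forall t, Rabs (w t) <= B) ->
  (forall t, Rabs (v t) <= B) ->
  forall t, 0 <= w t.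
Proof.
intros Hk Hw Hv Hh HwB HvB.
assert (Hp : forall t, 0 <= k * w t - v t).
{ apply (bounded_solution_nonneg k (k * B + B) (fun t => k * w t - v t) h Hk); [|exact Hh|].
  - intros t; evar_last.
    + apply (is_derive_minus (fun t => k * w t) v); [|apply Hv].
      apply (is_derive_scal w), Hw.
    + unfold minus, plus, opp; simpl; ring.
  - intros t; specialize (HwB t); specialize (HvB t).
    apply Rabs_le_between; apply Rabs_le_between in HwB; apply Rabs_le_between in HvB.
    nra. }
assert (Hq : forall t, 0 <= k * w (- t) + v (- t)).
{ apply (bounded_solution_nonneg k (k * B + B) (fun t => k * w (- t) + v (- t))
           (fun t => h (- t)) Hk).
  - intros t; evar_last.
    + apply (is_derive_reflect (fun t => k * w t + v t)
               (fun t => k * v t + (k * k * w t - h t))).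
      clear t; intros t.
      apply (is_derive_plus (fun t => k * w t) v); [|apply Hv].
      apply (is_derive_scal w), Hw.
    + simpl; ring.
  - intros t; apply Hh.
  - intros t; specialize (HwB (- t)); specialize (HvB (- t)).
    apply Rabs_le_between; apply Rabs_le_between in HwB; apply Rabs_le_between in HvB.
    nra. }
intros t; specialize (Hp t); specialize (Hq (- t)).
rewrite Ropp_involutive in Hq; nra.
Qed.

(** Combines the bounded solution [p] of [p' = - k p + h] with the time-reversed one [q], solving
    [q' = k q - h]. Then [(p + q) / (2 k)] is convolution of [h] with the Green function
    [exp (- k |t|) / (2 k)]. *)
Lemma bounded_second_order_solution (k M : R) (h : R -> R) :
  0 < k -> (forall t, continuous h t) -> (forall t, Rabs (h t) <= M) ->
  exists w v, (forall t, is_derive w t (v t)) /\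
    (forall t, is_derive v t (k * k * w t - h t)) /\
    (forall t, Rabs (w t) <= M / (k * k)) /\
    (forall t, Rabs (v t) <= M / k).
Proof.
intros Hk Hc HM.
destruct (bounded_solution_exists k M h Hk Hc HM) as [p [Hp HpM]].
destruct (bounded_solution_exists k M (fun t => h (- t)) Hk) as [r [Hr HrM]].
{ intros t; apply (continuous_comp Ropp h); [|apply Hc].
  apply (continuous_opp (fun t : R => t)), continuous_id. }
{ intros t; apply HM. }
set (q := fun t => r (- t)).
assert (Hq : forall t, is_derive q t (k * q t - h t)).
{ intros t; evar_last.
  - apply (is_derive_reflect r _ Hr).
  - simpl; unfold q; rewrite Ropp_involutive; ring. }
assert (HqM : forall t, Rabs (q t) <= M / k) by (intros t; apply HrM).
exists (fun t => / (2 * k) * (p t + q t)), (fun t => / 2 * (q t - p t)).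
split; [|split; [|split]].
- intros t; evar_last.
  + apply (is_derive_scal (fun t => p t + q t)).
    apply (is_derive_plus p q); [apply Hp|apply Hq].
  + unfold plus; simpl; field; lra.
- intros t; evar_last.
  + apply (is_derive_scal (fun t => q t - p t)).
    apply (is_derive_minus q p); [apply Hq|apply Hp].
  + unfold minus, plus, opp; simpl; field; lra.
- intros t; specialize (HpM t); specialize (HqM t).
  apply Rabs_le_between in HpM; apply Rabs_le_between in HqM.
  rewrite Rabs_mult, (Rabs_pos_eq (/ (2 * k)))
    by (apply Rlt_le, Rinv_0_lt_compat; lra).
  replace (M / (k * k)) with (/ (2 * k) * (2 * (M / k))) by (field; lra).
  apply Rmult_le_compat_l; [apply Rlt_le, Rinv_0_lt_compat; lra|].
  apply Rabs_le_between; lra.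
- intros t; specialize (HpM t); specialize (HqM t).
  apply Rabs_le_between in HpM; apply Rabs_le_between in HqM.
  apply Rabs_le_between; lra.
Qed.

(** * The method of lower and upper solutions on the whole line *)

Lemma lipschitz_continuous (u : R -> R) (L : R) :
  (forall s t, Rabs (u t - u s) <= L * Rabs (t - s)) ->
  forall t, continuous u t.
Proof.
intros HL t; apply continuity_pt_filterlim.
assert (HL0 : 0 <= L).
{ specialize (HL 0 1); pose proof (Rabs_pos (u 1 - u 0)).
  rewrite Rminus_0_r, Rabs_R1 in HL; lra. }
intros eps Heps; exists (eps / (L + 1)); split.
- apply Rdiv_lt_0_compat; lra.
- intros s [_ Hs]; unfold dist, R_met, R_dist in *; simpl in *.
  unfold R_dist in *.
  apply Rle_lt_trans with (1 := HL t s).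
  pose proof (Rabs_pos (s - t)).
  apply Rle_lt_trans with ((L + 1) * Rabs (s - t)); [nra|].
  replace eps with ((L + 1) * (eps / (L + 1))) by (field; lra).
  apply Rmult_lt_compat_l; lra.
Qed.

(* Lipschitz functions between [a] and [b] with a fixed constant form a complete lattice, on which
   the operator sending [u] to the bounded solution [w] of [w'' - k^2 w = F(t,u) - k^2 u] is
   monotone as soon as [k^2] exceeds the Lipschitz constant of [F(t,.)].  Its fixed point is
   obtained, as in Knaster-Tarski, as the supremum of all [u] lying below their image. *)
Lemma solution_between_lower_and_upper (F : R -> R -> R) (C N B : R)
    (a a' a'' b b' b'' : R -> R) :
  (forall u, (forall t, continuous u t) ->
     forall t, continuous (fun s => F s (u s)) t) ->
  (forall t x y, Rabs (F t x - F t y) <= C * Rabs (x - y)) ->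
  (forall t x, Rabs (F t x) <= N) ->
  (forall t, is_derive a t (a' t)) -> (forall t, is_derive a' t (a'' t)) ->
  (forall t, is_derive b t (b' t)) -> (forall t, is_derive b' t (b'' t)) ->
  (forall t, Rabs (a t) <= B) -> (forall t, Rabs (b t) <= B) ->
  (forall t, Rabs (a' t) <= B) -> (forall t, Rabs (b' t) <= B) ->
  (forall t, F t (a t) <= a'' t) -> (forall t, b'' t <= F t (b t)) ->
  (forall t, a t <= b t) ->
  exists x v, forall t, is_derive x t (v t) /\ is_derive v t (F t (x t)) /\
    a t <= x t <= b t.
Proof.
intros HFc HFC HFN Ha Ha' Hb Hb' HaB HbB Ha'B Hb'B HaF HbF Hab.
assert (HC : 0 <= C).
{ specialize (HFC 0 1 0); pose proof (Rabs_pos (F 0 1 - F 0 0)).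
  rewrite Rminus_0_r, Rabs_R1 in HFC; lra. }
assert (HB : 0 <= B) by (pose proof (Rabs_pos (a 0)); specialize (HaB 0); lra).
set (k := C + 1).
assert (Hk : 0 < k) by (unfold k; lra).
assert (HkC : C <= k * k) by (unfold k; nra).
set (h := fun (u : R -> R) t => k * k * u t - F t (u t)).
assert (Hhmono : forall u1 u2 t, u1 t <= u2 t -> h u1 t <= h u2 t).
{ intros u1 u2 t H; unfold h; specialize (HFC t (u2 t) (u1 t)).
  rewrite (Rabs_pos_eq (u2 t - u1 t)) in HFC by lra.
  apply Rabs_le_between in HFC; nra. }
set (M := k * k * B + N).
(* [M] bounds [h u] whenever [a <= u <= b]. [L] dominates both [|a'| <= B] and the bound [M / k] on
   derivatives of images, so [a] and all images are [L]-Lipschitz. *)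
set (L := B + M / k).
assert (HM0 : 0 <= M / k).
{ specialize (HFN 0 0); pose proof (Rabs_pos (F 0 0)).
  apply Rmult_le_pos; [unfold M; nra|apply Rlt_le, Rinv_0_lt_compat, Hk]. }
set (lip := fun u : R -> R => forall s t, Rabs (u t - u s) <= L * Rabs (t - s)).
set (X := fun u : R -> R => lip u /\ forall t, a t <= u t <= b t).
(* The operator is encoded as a relation, which avoids choosing a solution for each [u]. The
   recorded bounds allow [bounded_supersolution_nonneg] to be applied to differences. *)
set (S := fun u w : R -> R => exists v : R -> R, (forall t, is_derive w t (v t)) /\
    (forall t, is_derive v t (k * k * w t - h u t)) /\
    (forall t, Rabs (w t) <= M / (k * k)) /\
    (forall t, Rabs (v t) <= M / k)).
assert (Smono : forall u1 u2 w1 w2, S u1 w1 -> S u2 w2 ->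
  (forall t, u1 t <= u2 t) -> forall t, w1 t <= w2 t).
{ intros u1 u2 w1 w2 [v1 (Hw1 & Hv1 & Bw1 & Bv1)] [v2 (Hw2 & Hv2 & Bw2 & Bv2)] Hu t.
  enough (0 <= w2 t - w1 t) by lra; revert t.
  apply (bounded_supersolution_nonneg k (2 * (M / (k * k)) + 2 * (M / k))
           (fun t => w2 t - w1 t) (fun t => v2 t - v1 t) (fun t => h u2 t - h u1 t) Hk).
  - intros t; apply (is_derive_minus w2 w1); [apply Hw2|apply Hw1].
  - intros t; evar_last.
    + apply (is_derive_minus v2 v1); [apply Hv2|apply Hv1].
    + unfold minus, plus, opp; simpl; ring.
  - intros t; specialize (Hhmono u1 u2 t (Hu t)); lra.
  - intros t; specialize (Bw1 t); specialize (Bw2 t).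
    apply Rabs_le_between in Bw1; apply Rabs_le_between in Bw2.
    apply Rabs_le_between; lra.
  - intros t; specialize (Bv1 t); specialize (Bv2 t).
    pose proof (Rabs_pos (w1 t)); specialize (Bw1 t).
    apply Rabs_le_between in Bv1; apply Rabs_le_between in Bv2.
    apply Rabs_le_between; lra. }
(* The source for [w - a] splits into [h u - h a], nonnegative by monotonicity, and [a'' - F t a],
   nonnegative since [a] is a lower solution. *)
assert (Sa : forall u w, S u w -> (forall t, a t <= u t) -> forall t, a t <= w t).
{ intros u w [v (Hw & Hv & Bw & Bv)] Hu t.
  enough (0 <= w t - a t) by lra; revert t.
  apply (bounded_supersolution_nonneg k (B + M / (k * k) + M / k)
           (fun t => w t - a t) (fun t => v t - a' t)
           (fun t => h u t - h a t + (a'' t - F t (a t))) Hk).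
  - intros t; apply (is_derive_minus w a); [apply Hw|apply Ha].
  - intros t; evar_last.
    + apply (is_derive_minus v a'); [apply Hv|apply Ha'].
    + unfold minus, plus, opp; simpl; unfold h; ring.
  - intros t; specialize (Hhmono a u t (Hu t)); specialize (HaF t); lra.
  - intros t; specialize (Bw t); specialize (HaB t).
    apply Rabs_le_between in Bw; apply Rabs_le_between in HaB.
    apply Rabs_le_between; lra.
  - intros t; specialize (Bv t); specialize (Ha'B t).
    pose proof (Rabs_pos (w t)); specialize (Bw t).
    apply Rabs_le_between in Bv; apply Rabs_le_between in Ha'B.
    apply Rabs_le_between; lra. }
assert (Sb : forall u w, S u w -> (forall t, u t <= b t) -> forall t, w t <= b t).
{ intros u w [v (Hw & Hv & Bw & Bv)] Hu t.
  enough (0 <= b t - w t) by lra; revert t.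
  apply (bounded_supersolution_nonneg k (B + M / (k * k) + M / k)
           (fun t => b t - w t) (fun t => b' t - v t)
           (fun t => h b t - h u t + (F t (b t) - b'' t)) Hk).
  - intros t; apply (is_derive_minus b w); [apply Hb|apply Hw].
  - intros t; evar_last.
    + apply (is_derive_minus b' v); [apply Hb'|apply Hv].
    + unfold minus, plus, opp; simpl; unfold h; ring.
  - intros t; specialize (Hhmono u b t (Hu t)); specialize (HbF t); lra.
  - intros t; specialize (Bw t); specialize (HbB t).
    apply Rabs_le_between in Bw; apply Rabs_le_between in HbB.
    apply Rabs_le_between; lra.
  - intros t; specialize (Bv t); specialize (Hb'B t).
    pose proof (Rabs_pos (w t)); specialize (Bw t).
    apply Rabs_le_between in Bv; apply Rabs_le_between in Hb'B.
    apply Rabs_le_between; lra. }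
assert (Sex : forall u, X u -> exists w, S u w).
{ intros u [Hlip Hu].
  assert (Huc : forall t, continuous u t) by (apply (lipschitz_continuous u L Hlip)).
  apply (bounded_second_order_solution k M (h u) Hk).
  - intros t; apply (continuous_minus (fun t => k * k * u t) (fun t => F t (u t))).
    + apply (continuous_scal_r (k * k) u), Huc.
    + apply HFc, Huc.
  - intros t; unfold h, M; specialize (HFN t (u t)); specialize (Hu t).
    specialize (HaB t); specialize (HbB t).
    apply Rabs_le_between in HaB; apply Rabs_le_between in HbB.
    apply Rabs_le_between in HFN; apply Rabs_le_between; nra. }
assert (SX : forall u w, X u -> S u w -> X w).
{ intros u w [_ Hu] HS; split.
  - destruct HS as [v (Hw & _ & _ & Bv)]; unfold lip.
    apply (is_derive_lipschitz w v L Hw).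
    intros t; specialize (Bv t); unfold L; lra.
  - intros t; split; [apply (Sa u)|apply (Sb u)]; try exact HS; intros s; apply Hu. }
assert (Xa : X a).
{ split.
  - unfold lip; apply (is_derive_lipschitz a a' L Ha).
    intros t; specialize (Ha'B t); unfold L; lra.
  - intros t; specialize (Hab t); lra. }
set (Y := fun u => X u /\ exists w, S u w /\ forall t, u t <= w t).
assert (Ya : Y a).
{ split; [exact Xa|].
  destruct (Sex a Xa) as [w Hw]; exists w; split; [exact Hw|].
  apply (Sa a w Hw); intros; lra. }
set (E := fun t y => exists u, Y u /\ y = u t).
assert (HEb : forall t, bound (E t)).
{ intros t; exists (b t); intros y [u [[[_ Hu] _] ->]]; apply Hu. }
assert (HEi : forall t, exists y, E t y).
{ intros t; exists (a t), a; split; [exact Ya|reflexivity]. }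
set (x := fun t => proj1_sig (completeness (E t) (HEb t) (HEi t))).
assert (Hx : forall t, is_lub (E t) (x t)).
{ intros t; exact (proj2_sig (completeness (E t) (HEb t) (HEi t))). }
assert (Yx : forall u, Y u -> forall t, u t <= x t).
{ intros u Hu t; apply (Hx t); exists u; split; [exact Hu|reflexivity]. }
(* The common Lipschitz constant survives the pointwise supremum; this gives the continuity required
   to apply the operator to [x]. *)
assert (Xx : X x).
{ assert (Hle : forall s t, x t - x s <= L * Rabs (t - s)).
  { intros s t; enough (x t <= x s + L * Rabs (t - s)) by lra.
    apply (Hx t); intros y [u [Hu ->]].
    pose proof (Yx u Hu s).
    destruct Hu as [[Hlip _] _]; specialize (Hlip s t).
    apply Rabs_le_between in Hlip; lra. }
  split.
  - intros s t; apply Rabs_le_between; split; [|apply Hle].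
    specialize (Hle t s); rewrite Rabs_minus_sym in Hle; lra.
  - intros t; split; [apply (Yx a Ya)|].
    apply (Hx t); intros y [u [[[_ Hu] _] ->]]; apply Hu. }
destruct (Sex x Xx) as [w Sw].
(* Each [u] in [Y] satisfies [u <= x], so its image lies below the image [w] of [x]; hence [w] is an
   upper bound of [Y]. *)
assert (Hxw : forall t, x t <= w t).
{ intros t; apply (Hx t); intros y [u [Hu ->]].
  pose proof (Yx u Hu) as Hux; destruct Hu as [_ [w' [Sw' Hw']]].
  apply Rle_trans with (1 := Hw' t).
  apply (Smono u x w' w Sw' Sw Hux). }
(* Applying the operator to [x <= w] shows that [w] lies below its own image, so [w] belongs to [Y]
   and [w <= x]. *)
assert (Hwx : forall t, w t = x t).
{ intros t; apply Rle_antisym; [|apply Hxw].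
  apply Yx; split; [apply (SX x w Xx Sw)|].
  destruct (Sex w (SX x w Xx Sw)) as [z Sz]; exists z; split; [exact Sz|].
  apply (Smono x w w z Sw Sz Hxw). }
destruct Sw as [v (Hw & Hv & _ & _)].
exists x, v; intros t; split; [|split].
- apply (is_derive_ext w); [exact Hwx|apply Hw].
- replace (F t (x t)) with (k * k * w t - h x t); [apply Hv|].
  rewrite Hwx; unfold h; ring.
- apply Xx.
Qed.

(** * Application to the pendulum equation *)

Lemma Rabs_mult_le (x y p q : R) :
  Rabs x <= p -> Rabs y <= q -> Rabs (x * y) <= p * q.
Proof.
intros Hx Hy; rewrite Rabs_mult.
apply Rmult_le_compat; auto using Rabs_pos.
Qed.

Theorem theorem3p1 (f g : R -> R) (T : R) :
  (* f smooth, with f and f' bounded on R *)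
  (exists D : nat -> R -> R, deriv_tower f D /\
     exists M : R, forall t : R, Rabs (D 0%nat t) <= M /\ Rabs (D 1%nat t) <= M) ->
  (* g smooth, T-periodic with T > 0, zero mean *)
  smooth g ->
  0 < T ->
  (forall t : R, g (t + T) = g t) ->
  (exists pr : Riemann_integrable g 0 T, RiemannInt pr / T = 0) ->
  exists lambda0 : R, forall lambda : R, 0 < lambda -> lambda0 <= lambda ->
    exists x : R -> R, is_solution f g lambda x /\
      forall t : R, 0 < t -> 0 < x t < PI.
Proof.
intros [D [[HD0 HD] [M HM]]] [E [HE0 HE]] HT Hg [pr Hpr].
assert (Hfc : forall t, continuous f t).
{ intros t; apply (continuous_ext (D 0%nat)); [exact HD0|].
  apply (ex_derive_continuous (D 0%nat)); eexists; apply is_derive_Reals, HD. }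
assert (Hgc : forall t, continuous g t).
{ intros t; apply (continuous_ext (E 0%nat)); [exact HE0|].
  apply (ex_derive_continuous (E 0%nat)); eexists; apply is_derive_Reals, HE. }
assert (HfM : forall t, Rabs (f t) <= M) by (intros t; rewrite <- HD0; apply HM).
assert (HM0 : 0 <= M) by (pose proof (Rabs_pos (f 0)); specialize (HfM 0); lra).
destruct (periodic_continuous_bounded g T HT Hg Hgc) as [Mg [HMg0 HMg]].
assert (Hg0 : RInt g 0 T = 0).
{ rewrite (RInt_Reals g 0 T pr).
  replace (RiemannInt pr) with (RiemannInt pr / T * T) by (field; lra).
  rewrite Hpr; apply Rmult_0_l. }
destruct (periodic_primitive g T HT Hg Hgc Hg0) as [G (HG & HGp & HG0)].
assert (HGc : forall t, continuous G t).
{ intros t; apply (ex_derive_continuous G); eexists; apply HG. }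
destruct (periodic_continuous_bounded G T HT HGp HGc) as [BG [HBG0 HBG]].
destruct (periodic_primitive G T HT HGp HGc HG0) as [H (HH & HHp & _)].
assert (HHc : forall t, continuous H t).
{ intros t; apply (ex_derive_continuous H); eexists; apply HH. }
destruct (periodic_continuous_bounded H T HT HHp HHc) as [BH [HBH0 HBH]].
(* [c] bounds the right-hand side and its Lipschitz constant in [x], and also the error terms linear
   in [a]. The threshold for [l] is set to give [c * a t <= 1/2], using [a <= 3 BH / l^2] and
   [l >= 1]. *)
set (c := 1 + M + Mg).
exists (Rmax 1 (6 * c * BH)); intros l Hl Hl0.
assert (Hl1 : 1 <= l) by (apply Rle_trans with (1 := Rmax_l _ _) (2 := Hl0)).
assert (Hl2 : 6 * c * BH <= l) by (apply Rle_trans with (1 := Rmax_r _ _) (2 := Hl0)).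
clear Hl0.
set (s := / (l * l)).
assert (Hs : 0 < s) by (apply Rinv_0_lt_compat; nra).
assert (Hsl : s * (l * l) = 1) by (unfold s; field; lra).
assert (Hc1 : 1 <= c) by (unfold c; lra).
assert (HcB : 6 * c * (BH * s) <= 1).
{ apply Rle_trans with (l * l * s); [|lra].
  replace (6 * c * (BH * s)) with (6 * c * BH * s) by ring.
  apply Rmult_le_compat_r; nra. }
(* Here [d = 2 BH / l^2]; as [|H| <= BH], [a] stays between [BH * s] and [3 * BH * s]. *)
set (a := fun t => s * (2 * BH - H (l * t))).
set (a' := fun t => - / l * G (l * t)).
assert (Ha : forall t, is_derive a t (a' t)).
{ intros t; evar_last.
  - apply (is_derive_scal (fun t => 2 * BH - H (l * t))).
    apply (is_derive_minus (fun _ => 2 * BH) (fun t => H (l * t))).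
    + apply (is_derive_const (K := R_AbsRing) (V := R_NormedModule) (2 * BH)).
    + apply (is_derive_comp H (fun t => l * t)); [apply HH|].
      instantiate (1 := l); auto_derive; [exact I|ring].
  - unfold minus, plus, opp, zero, scal; simpl; unfold mult; simpl.
    unfold a', s; field; lra. }
assert (Ha' : forall t, is_derive a' t (- g (l * t))).
{ intros t; evar_last.
  - apply (is_derive_scal (fun t => G (l * t))).
    apply (is_derive_comp G (fun t => l * t)); [apply HG|].
    instantiate (1 := l); auto_derive; [exact I|ring].
  - unfold scal; simpl; unfold mult; simpl; field; lra. }
assert (Hapos : forall t, 0 < a t <= 3 * (BH * s)).
{ intros t; unfold a; specialize (HBH (l * t)); apply Rabs_le_between in HBH.
  split; [apply Rmult_lt_0_compat; lra|nra]. }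
assert (Hasmall : forall t, c * a t <= / 2).
{ intros t; specialize (Hapos t).
  apply Rle_trans with (c * (3 * (BH * s))); [apply Rmult_le_compat_l; lra|lra]. }
assert (Ha2 : forall t, a t <= / 2).
{ intros t; specialize (Hapos t); specialize (Hasmall t); nra. }
assert (Ha'B : forall t, Rabs (a' t) <= BG).
{ intros t; rewrite <- (Rmult_1_l BG); unfold a'; apply Rabs_mult_le; [|apply HBG].
  rewrite Rabs_Ropp, Rabs_pos_eq by (apply Rlt_le, Rinv_0_lt_compat, Hl).
  rewrite <- Rinv_1; apply Rinv_le_contravar; lra. }
assert (Htrig : forall t, Rabs (f t * sin (a t)) <= M * a t /\
  Rabs (g (l * t) * (cos (a t) - 1)) <= Mg * a t /\ 1 - a t <= cos (a t)).
{ intros t; specialize (Hapos t).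
  pose proof (sin_lipschitz (a t) 0) as Hsin.
  pose proof (cos_lipschitz (a t) 0) as Hcos.
  rewrite sin_0, 2!Rminus_0_r, (Rabs_pos_eq (a t)) in Hsin by lra.
  rewrite cos_0, Rminus_0_r, (Rabs_pos_eq (a t)) in Hcos by lra.
  split; [|split].
  - apply Rabs_mult_le; [apply HfM|exact Hsin].
  - apply Rabs_mult_le; [apply HMg|exact Hcos].
  - apply Rabs_le_between in Hcos; lra. }
pose proof PI2_1 as HPI.
set (F := fun t x => f t * sin x - (1 + g (l * t)) * cos x).
destruct (solution_between_lower_and_upper F c c (PI + BG)
  a a' (fun t => - g (l * t)) (fun t => PI - a t) (fun t => - a' t) (fun t => g (l * t)))
  as [x [v Hx]].
- intros u Hu t; unfold F.
  apply (continuous_minus (fun t => f t * sin (u t)) (fun t => (1 + g (l * t)) * cos (u t))).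
  + apply (continuous_mult f (fun t => sin (u t))); [apply Hfc|].
    apply (continuous_comp u sin); [apply Hu|apply continuous_sin].
  + apply (continuous_mult (fun t => 1 + g (l * t)) (fun t => cos (u t))).
    * apply (continuous_plus (fun _ => 1) (fun t => g (l * t))); [apply continuous_const|].
      apply (continuous_comp (fun t => l * t) g); [|apply Hgc].
      apply (continuous_scal_r l (fun t : R => t)), continuous_id.
    * apply (continuous_comp u cos); [apply Hu|apply continuous_cos].
- intros t x y; unfold F.
  replace (f t * sin x - (1 + g (l * t)) * cos x - (f t * sin y - (1 + g (l * t)) * cos y))
    with (f t * (sin x - sin y) + (- (1 * (cos x - cos y)) - g (l * t) * (cos x - cos y)))
    by ring.
  pose proof (Rabs_mult_le _ _ _ _ (HfM t) (sin_lipschitz x y)) as H1.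
  pose proof (Rabs_mult_le _ _ _ _ (HMg (l * t)) (cos_lipschitz x y)) as H2.
  pose proof (cos_lipschitz x y) as H3.
  apply Rabs_le_between in H1; apply Rabs_le_between in H2; apply Rabs_le_between in H3.
  apply Rabs_le_between; unfold c; lra.
- intros t x; unfold F.
  pose proof (Rabs_mult_le _ _ _ _ (HfM t) (Rabs_le _ 1 (SIN_bound x))) as H1.
  pose proof (Rabs_mult_le _ _ _ _ (HMg (l * t)) (Rabs_le _ 1 (COS_bound x))) as H2.
  pose proof (COS_bound x).
  apply Rabs_le_between in H1; apply Rabs_le_between in H2.
  apply Rabs_le_between; unfold c; lra.
- exact Ha.
- exact Ha'.
- intros t; evar_last.
  + apply (is_derive_minus (fun _ => PI) a); [|apply Ha].
    apply (is_derive_const (K := R_AbsRing) (V := R_NormedModule) PI).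
  + unfold minus, plus, opp, zero; simpl; ring.
- intros t; evar_last.
  + apply (is_derive_opp a'), Ha'.
  + unfold opp; simpl; ring.
- intros t; specialize (Hapos t); specialize (Ha2 t); apply Rabs_le_between; lra.
- intros t; specialize (Hapos t); specialize (Ha2 t); apply Rabs_le_between; lra.
- intros t; specialize (Ha'B t); lra.
- intros t; rewrite Rabs_Ropp; specialize (Ha'B t); lra.
(* [F t a - a'' = f sin a - cos a - g (cos a - 1) <= M a - (1 - a) + Mg a = c a - 1 < 0]: the terms
   in [g] cancel up to order [a], and gravity decides the sign. *)
- intros t; unfold F; specialize (Hapos t); specialize (Hasmall t).
  destruct (Htrig t) as (H1 & H2 & H3).
  apply Rabs_le_between in H1; apply Rabs_le_between in H2; unfold c in Hasmall; lra.
(* Reflection turns [cos a] into [- cos a], and the same estimates give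
   [F t (PI - a) - g >= 1 - c a > 0], with [g] taken at [l * t]. *)
- intros t; unfold F; rewrite sin_PI_x, Rtrigo_facts.cos_pi_minus.
  specialize (Hapos t); specialize (Hasmall t).
  destruct (Htrig t) as (H1 & H2 & H3).
  apply Rabs_le_between in H1; apply Rabs_le_between in H2; unfold c in Hasmall; lra.
- intros t; specialize (Ha2 t); lra.
- exists x; split.
  + exists v; intros t; destruct (Hx t) as (H1 & H2 & _).
    split; apply is_derive_Reals; assumption.
  + intros t _; destruct (Hx t) as (_ & _ & H3); specialize (Hapos t); lra.
Qed.
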